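(* Assume the reduced operator $\widehat A_h\in\mathbb{R}^{n_h\times n_h}$ is square and invertible. Let $U_h^\pi=U_{0,h}+Z_hy_h^\pi$ be an admissible comparison vector with $\tau_h^\pi:=A_hU_h^\pi-b_h$, and let $T_h,\varepsilon_{i,h}^{\mathrm{eval}}$ be real numbers with $$T_h\ge\|\tau_h^\pi\|_{W_h},\qquad \varepsilon_{i,h}^{\mathrm{eval}}\ge|\ell_{i,h}^\top U_h^\pi-u^\star(x_i)|.$$ Set $\mu_{i,h}:=\sigma_{i,h}T_h+\varepsilon_{i,h}^{\mathrm{eval}}$, $r_h:=A_hU_\theta-b_h$, and define the corrected center $c_{i,h}^{\mathrm{corr}}:=\ell_{i,h}^\top U_\theta-g_{i,h}^\top r_h$. Then $$u^\star(x_i)\in\left[c_{i,h}^{\mathrm{corr}}-\mu_{i,h},\;c_{i,h}^{\mathrm{corr}}+\mu_{i,h}\right].$$ The interval centered at the numerical representation also contains the exact value: $$u^\star(x_i)\in\left[\ell_{i,h}^\top U_\theta-\rho_{i,h}^{\mathrm{pred}},\;\ell_{i,h}^\top U_\theta+\rho_{i,h}^{\mathrm{pred}}\right],\qquad \rho_{i,h}^{\mathrm{pred}}:=|g_{i,h}^\top r_h|+\mu_{i,h}.$$ If the reported center is an unprojected neural output $u_\theta(x_i)\in\mathbb{R}$, define $\rho_{i,h}^\theta:=|u_\theta(x_i)-c_{i,h}^{\mathrm{corr}}|+\mu_{i,h}$. Then $$u^\star(x_i)\in\left[u_\theta(x_i)-\rho_{i,h}^\theta,\;u_\theta(x_i)+\rho_{i,h}^\theta\right].$$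 Moreover, $\rho_{i,h}^\theta\le\zeta_{i,h}^\theta+\rho_{i,h}^{\mathrm{pred}}$, where $\zeta_{i,h}^\theta:=|u_\theta(x_i)-\ell_{i,h}^\top U_\theta|$.
   Context: Let $\Omega\subset\mathbb{R}^d$ be a bounded domain and $u^\star$ the exact solution (assumed unique in its admissible class) of a boundary-value problem on $\Omega$, with $u^\star(x_i)$ well defined at a query point $x_i\in\overline\Omega$. Let $U_{0,h}\in\mathbb{R}^{N_h}$ and let $Z_h\in\mathbb{R}^{N_h\times n_h}$ have full column rank; the admissible set is $U_{0,h}+Z_h\mathbb{R}^{n_h}$. Let $A_h\in\mathbb{R}^{M_h\times N_h}$, $b_h\in\mathbb{R}^{M_h}$, $\widehat A_h:=A_hZ_h$, $\widehat b_h:=b_h-A_hU_{0,h}$. In the square setting $M_h=n_h$. Let $W_h\in\mathbb{R}^{M_h\times M_h}$ be symmetric positive definite, $\|r\|_{W_h}:=(r^\top W_hr)^{1/2}$, $\|g\|_{W_h^{-1}}:=(g^\top W_h^{-1}g)^{1/2}$, $\widehat H_h:=\widehat A_h^\top W_h\widehat A_h$. The vector $U_\theta=U_{0,h}+Z_hy_\theta$ (with $y_\theta\in\mathbb{R}^{n_h}$) is an arbitrary admissible vector. To the query $x_i$ is attached a query vector $\ell_{i,h}\in\mathbb{R}^{N_h}$ (the discrete query value of a coefficient vector $U$ is $\ell_{i,h}^\top U$; for point evaluation it equals the value at $x_i$ of the linear reconstruction of $U$); put $\widehat\ell_{i,h}:=Z_h^\top\ell_{i,h}$, let $q_{i,h}$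 solve $\widehat H_hq_{i,h}=\widehat\ell_{i,h}$, and define $g_{i,h}:=W_h\widehat A_hq_{i,h}$, $\sigma_{i,h}:=\|g_{i,h}\|_{W_h^{-1}}$. *)

(* Defs.v *)
From HB Require Import structures.
From mathcomp Require Import all_boot all_order all_algebra.
From mathcomp Require Import all_classical all_reals all_analysis.

Set Implicit Arguments.
Unset Strict Implicit.
Unset Printing Implicit Defensive.

Import Order.TTheory GRing.Theory Num.Theory.
Import numFieldNormedType.Exports.

Local Open Scope classical_set_scope.
Local Open Scope ring_scope.

Definition bounded_domain (R : realType) (d : nat) (Omega : set 'rV[R]_d) : Prop :=
  [/\ open Omega, connected Omega, Omega !=set0 & bounded_set Omega].

(* No particular equation is fixed: the admissible class, the equation in the
   domain (in strong or weak form) and the boundary condition are arbitrary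
   predicates.  Functions are total on R^d; only their values on the closure
   of the domain are meaningful. *)
Record boundary_value_problem (R : realType) (d : nat) := BVP {
  bvp_class    : set ('rV[R]_d -> R);
  bvp_equation : set ('rV[R]_d -> R);
  bvp_boundary : set ('rV[R]_d -> R) }.

Definition bvp_solution (R : realType) (d : nat)
    (P : boundary_value_problem R d) (u : 'rV[R]_d -> R) : Prop :=
  [/\ bvp_class P u, bvp_equation P u & bvp_boundary P u].

Definition bvp_unique_solution (R : realType) (d : nat) (Omega : set 'rV[R]_d)
    (P : boundary_value_problem R d) (u : 'rV[R]_d -> R) : Prop :=
  bvp_solution P u /\
  forall v : 'rV[R]_d -> R, bvp_solution P v -> {in closure Omega, v =1 u}.

Definition dotc (R : realType) (n : nat) (x y : 'cV[R]_n) : R :=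
  (x^T *m y) 0 0.

Definition spd (R : realType) (n : nat) (W : 'M[R]_n) : Prop :=
  W^T = W /\ forall x : 'cV[R]_n, x != 0 -> 0 < dotc x (W *m x).

Definition wnorm (R : realType) (n : nat) (W : 'M[R]_n) (r : 'cV[R]_n) : R :=
  Num.sqrt (dotc r (W *m r)).

(* In the next three definitions Ah stands for the reduced operator A Z. *)
Definition normal_mx (R : realType) (m n : nat) (W : 'M[R]_m)
    (Ah : 'M[R]_(m, n)) : 'M[R]_n :=
  Ah^T *m W *m Ah.

Definition query_weight (R : realType) (m n : nat) (W : 'M[R]_m)
    (Ah : 'M[R]_(m, n)) (q : 'cV[R]_n) : 'cV[R]_m :=
  W *m Ah *m q.

Definition query_sensitivity (R : realType) (m n : nat) (W : 'M[R]_m)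
    (Ah : 'M[R]_(m, n)) (q : 'cV[R]_n) : R :=
  wnorm (invmx W) (query_weight W Ah q).

(* Main.v *)
(* Since [Ah^T g = H q = Z^T ell], one has [g . A (Utheta - Upi) =
   ell . (Utheta - Upi)]: subtracting [g . r] from [ell . Utheta] replaces
   Utheta by Upi, up to the term [g . tau].  The latter is at most
   [sigma * T] by the Cauchy-Schwarz inequality for the dual pair of norms
   of [W^-1] and [W].  The three intervals then follow by the triangle
   inequality. *)
Require Import Defs.
From HB Require Import structures.
From mathcomp Require Import all_boot all_order all_algebra.
From mathcomp Require Import all_classical all_reals all_analysis.
From mathcomp Require Import ring lra.

Import Order.TTheory GRing.Theory Num.Theory.
Import numFieldNormedType.Exports.

Local Open Scope classical_set_scope.
Local Open Scope ring_scope.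

Section WeightedNorm.
Set Implicit Arguments.
Unset Strict Implicit.
Context {R : realType}.

Lemma dotcC n (x y : 'cV[R]_n) : dotc x y = dotc y x.
Proof. by rewrite /dotc -[in RHS](trmxK x) -trmx_mul [RHS]mxE. Qed.

Lemma dotcDr n (x y z : 'cV[R]_n) : dotc x (y + z) = dotc x y + dotc x z.
Proof. by rewrite /dotc mulmxDr mxE. Qed.

Lemma dotcZr n a (x y : 'cV[R]_n) : dotc x (a *: y) = a * dotc x y.
Proof. by rewrite /dotc -scalemxAr mxE. Qed.

Lemma dotcDl n (x y z : 'cV[R]_n) : dotc (x + y) z = dotc x z + dotc y z.
Proof. by rewrite dotcC dotcDr !(dotcC z). Qed.

Lemma dotcZl n a (x y : 'cV[R]_n) : dotc (a *: x) y = a * dotc x y.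
Proof. by rewrite dotcC dotcZr dotcC. Qed.

Lemma dotc_mulmxr m n (M : 'M[R]_(m, n)) (x : 'cV[R]_m) (y : 'cV[R]_n) :
  dotc x (M *m y) = dotc (M^T *m x) y.
Proof. by rewrite /dotc trmx_mul trmxK mulmxA. Qed.

Lemma dotc0 n (x : 'cV[R]_n) : dotc x 0 = 0.
Proof. by rewrite /dotc mulmx0 mxE. Qed.

Lemma wnorm_ge0 n (W : 'M[R]_n) x : 0 <= wnorm W x.
Proof. exact: sqrtr_ge0. Qed.

Lemma spd_dotc_ge0 n (W : 'M[R]_n) x : spd W -> 0 <= dotc x (W *m x).
Proof.
case=> _ W_gt0; have [->|/W_gt0/ltW //] := eqVneq x 0.
by rewrite mulmx0 dotc0.
Qed.

(** If [v W = 0] for a row [v], symmetry gives [W v^T = 0], so the form vanishes at [v^T], which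
    positivity allows only for [v = 0]. *)
Lemma spd_unitmx n (W : 'M[R]_n) : spd W -> W \in unitmx.
Proof.
case=> WT W_gt0; rewrite -row_free_unit; apply: inj_row_free => v vW0.
apply: trmx_inj; rewrite trmx0; apply/eqP/negP => /negP/W_gt0.
by rewrite -WT -trmx_mul vW0 trmx0 dotc0 ltxx.
Qed.

Lemma spd_cauchy_schwarz n (W : 'M[R]_n) x y : spd W ->
  `|dotc x (W *m y)| <= wnorm W x * wnorm W y.
Proof.
move=> Wspd; have [WT W_gt0] := Wspd.
(* Writing the absolute value as the root of a square reduces the claim to
   [<x,y>^2 <= <x,x> <y,y>]. *)
rewrite /wnorm -sqrtrM ?spd_dotc_ge0// -sqrtr_sqr ler_wsqrtr//.
have [->|/W_gt0 yy_gt0] := eqVneq y 0.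
  by rewrite mulmx0 !dotc0 expr0n mulr0.
have yx : dotc y (W *m x) = dotc x (W *m y) by rewrite dotc_mulmxr WT dotcC.
(* The form at [<y,y> x - <x,y> y] equals [<y,y> (<x,x><y,y> - <x,y>^2)]. *)
have := spd_dotc_ge0 (dotc y (W *m y) *: x - dotc x (W *m y) *: y) Wspd.
rewrite -scaleNr mulmxDr -!scalemxAr !(dotcDl, dotcDr, dotcZl, dotcZr) yx.
set a := dotc x (W *m x); set c := dotc y (W *m y) in yy_gt0 *.
set e := dotc x (W *m y).
rewrite [X in 0 <= X](_ : _ = c * (a * c - e ^+ 2)); last by ring.
by rewrite pmulr_rge0// subr_ge0.
Qed.

(** The vector [W^-1 g] represents [x |-> g . x] in the inner product of [W], and its [W]-norm is
    the [W^-1]-norm of [g]. *)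
Lemma spd_dual_cauchy_schwarz n (W : 'M[R]_n) g x : spd W ->
  `|dotc g x| <= wnorm (invmx W) g * wnorm W x.
Proof.
move=> Wspd; have Wu := spd_unitmx Wspd; have [WT _] := Wspd.
have -> : wnorm (invmx W) g = wnorm W (invmx W *m g).
  by rewrite /wnorm mulKVmx// dotcC.
have -> : dotc g x = dotc (invmx W *m g) (W *m x).
  by rewrite dotc_mulmxr WT mulKVmx.
exact: spd_cauchy_schwarz.
Qed.

(** Moving [Ah] across the pairing turns [g] into [Ah^T W Ah q = H q]: weighting a residual
    increment by [g] reads off the query value of the increment that caused it. *)
Lemma query_weight_adjoint m n (W : 'M[R]_m) (Ah : 'M[R]_(m, n)) q l y :
  W^T = W -> normal_mx W Ah *m q = l ->
  dotc (query_weight W Ah q) (Ah *m y) = dotc l y.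
Proof. by move=> WT <-; rewrite dotc_mulmxr !mulmxA. Qed.

Lemma le_dist_itv (u c e : R) :
  `|c - u| <= e -> u \in `[c - e, c + e].
Proof. by rewrite ler_distl in_itv /= lerBlDr => /andP[]; lra. Qed.

End WeightedNorm.

Theorem theorem4p5 (R : realType) (d : nat) (Omega : set 'rV[R]_d)
  (P : boundary_value_problem R d) (ustar : 'rV[R]_d -> R) (xi : 'rV[R]_d)
  (N n : nat) (U0 : 'cV[R]_N) (Z : 'M[R]_(N, n))
  (A : 'M[R]_(n, N)) (b : 'cV[R]_n) (W : 'M[R]_n)
  (ell : 'cV[R]_N) (q : 'cV[R]_n)
  (ytheta ypi : 'cV[R]_n) (T epseval : R) (utheta : 'rV[R]_d -> R) :
  bounded_domain Omega ->
  bvp_unique_solution Omega P ustar ->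
  closure Omega xi ->
  \rank Z = n ->
  spd W ->
  let Ah := A *m Z in
  Ah \in unitmx ->
  normal_mx W Ah *m q = Z^T *m ell ->
  let g := query_weight W Ah q in
  let sigma := query_sensitivity W Ah q in
  let Utheta := U0 + Z *m ytheta in
  let Upi := U0 + Z *m ypi in
  let tau := A *m Upi - b in
  wnorm W tau <= T ->
  `|dotc ell Upi - ustar xi| <= epseval ->
  let mu := sigma * T + epseval in
  let r := A *m Utheta - b in
  let ccorr := dotc ell Utheta - dotc g r in
  let rhopred := `|dotc g r| + mu in
  let rhotheta := `|utheta xi - ccorr| + mu in
  let zeta := `|utheta xi - dotc ell Utheta| in
  [/\ ustar xi \in `[ccorr - mu, ccorr + mu],
      ustar xi \in `[dotc ell Utheta - rhopred, dotc ell Utheta + rhopred],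
      ustar xi \in `[utheta xi - rhotheta, utheta xi + rhotheta]
    & rhotheta <= zeta + rhopred].
Proof.
move=> _ _ _ _ Wspd Ah _ Hq g sigma Utheta Upi tau tauT leeps mu r ccorr
  rhopred rhotheta zeta.
have gtau : `|dotc g tau| <= sigma * T.
  apply: (le_trans (spd_dual_cauchy_schwarz g tau Wspd)).
  by rewrite ler_wpM2l// wnorm_ge0.
have ccorrE : ccorr = dotc ell Upi - dotc g tau.
  (* Two admissible vectors differ by an element of the range of [Z], on which [A] acts through
     [Ah]. *)
  have U_eq : Utheta = Upi + Z *m (ytheta - ypi).
    by rewrite mulmxBr addrACA subrr addr0 // addrC.
  have r_eq : r = tau + Ah *m (ytheta - ypi).
    by rewrite /r /tau U_eq mulmxDr mulmxA addrAC.
  rewrite /ccorr r_eq U_eq (dotcDr g tau) (dotcDr ell Upi)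
    (query_weight_adjoint _ Wspd.1 Hq).
  (* Here [ell . Z y = (Z^T ell) . y], which cancels the adjoint term. *)
  by rewrite (dotc_mulmxr Z); ring.
have ccorr_dist : `|ccorr - ustar xi| <= mu.
  rewrite ccorrE addrAC /mu [leRHS]addrC.
  exact: le_trans (ler_normB _ _) (lerD leeps gtau).
(* Recentering at any [c] costs only its distance to the corrected center; this dictates the form of
   both [rhopred] and [rhotheta]. *)
have dist_center c : `|c - ustar xi| <= `|c - ccorr| + mu.
  exact: le_trans (ler_distD ccorr _ _) (lerD (lexx _) ccorr_dist).
have pred_dist : dotc ell Utheta - ccorr = dotc g r by rewrite /ccorr; ring.
split.
- exact: le_dist_itv.
- by apply: le_dist_itv; rewrite /rhopred -pred_dist.
- exact: le_dist_itv.
(* After cancelling [mu], this is the triangle inequality through [ell . Utheta]. *)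
- by rewrite /rhotheta /rhopred -pred_dist [leRHS]addrA lerD2r ler_distD.
Qed.
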